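(* Let $(M,d)$ be a complete geodesic space which is uniformly $\infty$-convex. Then the following are equivalent: (1) $(M,d)$ is a $CAT(0)$-space; (2) $(M,d)$ is Busemann convex and satisfies the stable non-expansive projection property $(NE^* )$; (3) $(M,d)$ is Busemann convex and satisfies the stable symmetric orthogonality property $(SO^* )$.
   Context: Geodesics are maps $\gamma:[0,1]\to X$ with $\delta(\gamma_t,\gamma_s)=|t-s|\delta(\gamma_0,\gamma_1)$. Uniformly $\infty$-convex: there is $\rho:(0,\infty)\to(0,\infty)$ such that for all $\epsilon>0$ and $x,y,z$ with $d(y,z)>\epsilon\max\{d(x,y),d(x,z)\}$ and every midpoint $m$ of $y,z$, $d(x,m)\le(1-\rho(\epsilon))\max\{d(x,y),d(x,z)\}$. Busemann convex: for all geodesics $\gamma,\eta$ with $\gamma_0=\eta_0$, $d(\gamma_{1/2},\eta_{1/2})\le\frac12d(\gamma_1,\eta_1)$. $CAT(0)$: for all $x,y,z$ and a Euclidean triangle $\tilde x,\tilde y,\tilde z$ with the same side lengths, $d(x,m)\le\|\tilde x-\tilde m\|$ for the midpoints $m$ of $y,z$ and $\tilde m$ of $\tilde y,\tilde z$. In a geodesic space $(X,\delta)$: for $p=\gamma_0=\eta_0$, $\gamma\perp_p\eta$ means $\delta(p,\gamma_t)\le\delta(\eta_s,\gamma_t)$ for all $s,t$; $(SO)$ means $\gamma\perp_p\eta\Rightarrow\eta\perp_p\gamma$; $(NE)$ means for all closed weakly convex $C$ (any two points joined by some geodesic in $C$) and $x,y\in X$, $\delta(x_C,y_C)\le\delta(x,y)$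 for $x_C\in\pi_C(x)$, $y_C\in\pi_C(y)$, where $\pi_C(x)$ is the set of nearest points of $x$ in $C$. $(SO^* )$, resp. $(NE^* )$, means that $M\times_2\mathbb{R}$ ($M\times\mathbb{R}$ with $\tilde d((x,t),(y,s))^2=d(x,y)^2+|t-s|^2$) satisfies $(SO)$, resp. $(NE)$. *)

(* Defs.v *)
From Stdlib Require Import Reals Lra.
Open Scope R_scope.

Section Metric.
Variable X : Type.
Variable dist : X -> X -> R.

Definition is_metric : Prop :=
  (forall x y, 0 <= dist x y) /\
  (forall x y, dist x y = 0 <-> x = y) /\
  (forall x y, dist x y = dist y x) /\
  (forall x y z, dist x z <= dist x y + dist y z).

Definition cauchy_seq (u : nat -> X) : Prop :=
  forall eps, 0 < eps -> exists N, forall n m, (N <= n)%nat -> (N <= m)%nat ->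
    dist (u n) (u m) < eps.

Definition converges_to (u : nat -> X) (x : X) : Prop :=
  forall eps, 0 < eps -> exists N, forall n, (N <= n)%nat -> dist (u n) x < eps.

Definition complete : Prop :=
  forall u, cauchy_seq u -> exists x, converges_to u x.

(* A geodesic gamma : [0,1] -> X (values outside [0,1] are irrelevant). *)
Definition geodesic (g : R -> X) : Prop :=
  forall t s, 0 <= t <= 1 -> 0 <= s <= 1 ->
    dist (g t) (g s) = Rabs (t - s) * dist (g 0) (g 1).

Definition geodesic_space : Prop :=
  forall x y, exists g, geodesic g /\ g 0 = x /\ g 1 = y.

Definition is_midpoint (y z m : X) : Prop :=
  dist y m = dist y z / 2 /\ dist m z = dist y z / 2.

Definition uniformly_inf_convex : Prop :=
  exists rho : R -> R, (forall e, 0 < e -> 0 < rho e) /\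
    forall e x y z m, 0 < e ->
      dist y z > e * Rmax (dist x y) (dist x z) ->
      is_midpoint y z m ->
      dist x m <= (1 - rho e) * Rmax (dist x y) (dist x z).

Definition busemann_convex : Prop :=
  forall g h, geodesic g -> geodesic h -> g 0 = h 0 ->
    dist (g (1/2)) (h (1/2)) <= 1/2 * dist (g 1) (h 1).

Definition orth (p : X) (g h : R -> X) : Prop :=
  g 0 = p /\ h 0 = p /\
  forall s t, 0 <= s <= 1 -> 0 <= t <= 1 -> dist p (g t) <= dist (h s) (g t).

Definition SO : Prop :=
  forall p g h, geodesic g -> geodesic h -> g 0 = p -> h 0 = p ->
    orth p g h -> orth p h g.

Definition closed_set (C : X -> Prop) : Prop :=
  forall x, ~ C x -> exists r, 0 < r /\ forall y, dist x y < r -> ~ C y.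

Definition weakly_convex (C : X -> Prop) : Prop :=
  forall x y, C x -> C y -> exists g, geodesic g /\ g 0 = x /\ g 1 = y /\
    forall t, 0 <= t <= 1 -> C (g t).

Definition proj_set (C : X -> Prop) (x c : X) : Prop :=
  C c /\ forall c', C c' -> dist x c <= dist x c'.

Definition NE : Prop :=
  forall C x y xC yC, closed_set C -> weakly_convex C ->
    proj_set C x xC -> proj_set C y yC -> dist xC yC <= dist x y.

End Metric.

Definition eucl (p q : R * R) : R :=
  sqrt ((fst p - fst q)^2 + (snd p - snd q)^2).

Definition emid (p q : R * R) : R * R :=
  ((fst p + fst q) / 2, (snd p + snd q) / 2).

Definition CAT0 (X : Type) (dist : X -> X -> R) : Prop :=
  forall (x y z : X) (tx ty tz : R * R),
    eucl tx ty = dist x y -> eucl tx tz = dist x z -> eucl ty tz = dist y z ->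
    forall m, is_midpoint X dist y z m -> dist x m <= eucl tx (emid ty tz).

Definition prod2_dist (X : Type) (dist : X -> X -> R) (p q : X * R) : R :=
  sqrt (dist (fst p) (fst q) ^ 2 + Rabs (snd p - snd q) ^ 2).

Definition SO_star (X : Type) (dist : X -> X -> R) : Prop :=
  SO (X * R) (prod2_dist X dist).

Definition NE_star (X : Type) (dist : X -> X -> R) : Prop :=
  NE (X * R) (prod2_dist X dist).

(* Main.v *)
Require Import Defs.
From Stdlib Require Import Reals Lra Lia Psatz.

(** The bridge is the CN inequality (the comparison inequality at midpoints),
    which is equivalent to CAT(0) and passes to [M x R].  It gives Pythagoras'
    inequality at a foot point, hence symmetric orthogonality, and, with the
    quadrilateral inequality, non-expansiveness of projections.  Projecting on
    the image of a geodesic shows that non-expansiveness implies symmetric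
    orthogonality.

    Conversely let [sg] and [et] be geodesics issuing from [q] and ending at
    [x] and [y].  Orthogonality of the lifts [(sg t, c t)] and [(et s, b s)]
    says that the derivative of [d x (et s)] at [s = 0] is at least
    [b c / d q x]; so stable symmetry identifies this derivative with that of
    [d y (.) ^ 2 / 2] at [q] in the direction of [x].  If [q'] lies between [q]
    and [x], and [et'] joins [q'] to [y], Busemann convexity gives
    [d (et s) (et' s) <= (1 - s) d q q'], so the derivative at [q'] exceeds
    the one at [q] by at least [d q q']: along geodesics [d y (.) ^ 2 / 2] is
    1-convex, which is CN. *)

(** The inequality of Bruhat and Tits: the right-hand side is the squared median of the Euclidean
    triangle with the same sides. *)
Definition CN (X : Type) (d : X -> X -> R) : Prop :=
  forall x y z m, is_midpoint X d y z m ->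
    d x m ^ 2 <= d x y ^ 2 / 2 + d x z ^ 2 / 2 - d y z ^ 2 / 4.

(** * Real functions *)

Lemma le_0_of_le_geom (a b : R) :
  (forall n, a <= b * (1 / 2) ^ n) -> a <= 0.
Proof.
intros H. destruct (Rle_lt_dec a 0) as [|Ha]; [assumption|exfalso].
assert (Hb : 0 < b) by (specialize (H 0%nat); simpl in H; lra).
destruct (pow_lt_1_zero (1/2)) with (y := a / b) as [N HN].
- rewrite Rabs_right; lra.
- apply Rdiv_lt_0_compat; lra.
- specialize (HN N (Nat.le_refl N)). specialize (H N).
  rewrite Rabs_right in HN by (apply Rle_ge, pow_le; lra).
  apply (Rmult_lt_compat_l b) in HN; [|assumption].
  replace (b * (a / b)) with a in HN by (field; lra). lra.
Qed.

(** The upper bound [B] does the work of continuity in passing from midpoint convexity to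
    convexity. *)
Lemma midpoint_convex_chord (f : R -> R) (B : R) :
  (forall s t, 0 <= s <= 1 -> 0 <= t <= 1 -> f ((s + t) / 2) <= (f s + f t) / 2) ->
  (forall t, 0 <= t <= 1 -> f t <= B) ->
  forall t, 0 <= t <= 1 -> f t <= (1 - t) * f 0 + t * f 1.
Proof.
intros Hm HB.
set (h := fun t => f t - ((1 - t) * f 0 + t * f 1)).
(* Halving [t] towards an end point halves the excess over the chord. *)
assert (Hn : forall n t, 0 <= t <= 1 ->
          h t <= (B + Rabs (f 0) + Rabs (f 1)) * (1 / 2) ^ n).
{ induction n as [|n IH]; intros t Ht; unfold h in *.
  - simpl. specialize (HB t Ht).
    assert (- ((1 - t) * f 0) <= Rabs (f 0)).
    { pose proof (Rabs_pos (f 0)). pose proof (Rle_abs (- f 0)).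
      rewrite Rabs_Ropp in *. nra. }
    assert (- (t * f 1) <= Rabs (f 1)).
    { pose proof (Rabs_pos (f 1)). pose proof (Rle_abs (- f 1)).
      rewrite Rabs_Ropp in *. nra. }
    lra.
  - simpl. destruct (Rle_lt_dec t (1/2)) as [Hl|Hl].
    + pose proof (IH (2 * t)) as I. pose proof (Hm 0 (2 * t)) as J.
      replace ((0 + 2 * t) / 2) with t in J by field.
      assert (0 <= 2 * t <= 1) by lra. specialize (I H).
      assert (0 <= 0 <= 1) by lra. specialize (J H0 H). nra.
    + pose proof (IH (2 * t - 1)) as I. pose proof (Hm 1 (2 * t - 1)) as J.
      replace ((1 + (2 * t - 1)) / 2) with t in J by field.
      assert (0 <= 2 * t - 1 <= 1) by lra. specialize (I H).
      assert (0 <= 1 <= 1) by lra. specialize (J H0 H). nra. }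
intros t Ht.
assert (h t <= 0) by (eapply le_0_of_le_geom; intro n; apply Hn, Ht).
unfold h in *. lra.
Qed.

(** At 0 the slope of [e ^ 2] is [2 * e 0] times that of [e], and by convexity the initial slope of
    [e] bounds all its chords from below. *)
Lemma convex_slope_of_sqr (e : R -> R) (k : R) :
  0 < e 0 -> (forall s, 0 <= s <= 1 -> 0 <= e s) ->
  (forall l s, 0 <= l <= 1 -> 0 <= s <= 1 -> e (l * s) <= (1 - l) * e 0 + l * e s) ->
  (forall s, 0 <= s <= 1 -> e 0 ^ 2 + 2 * e 0 * k * s <= e s ^ 2) ->
  forall s, 0 <= s <= 1 -> e 0 + k * s <= e s.
Proof.
intros H0 Hp Hc Hs s Hs1.
set (w := e s - e 0).
(* Compare at [l * s] and divide by [l]: only the quadratic error [l * w ^ 2] remains. *)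
assert (key : forall l, 0 < l <= 1 -> 2 * e 0 * (k * s - w) <= l * w ^ 2).
{ intros l Hl.
  assert (Hls : 0 <= l * s <= 1) by nra.
  assert (Hl' : 0 <= l <= 1) by lra.
  pose proof (Hp _ Hls) as P1. pose proof (Hc l s Hl' Hs1) as P2.
  pose proof (Hs _ Hls) as P3.
  assert (P4 : e (l * s) <= e 0 + l * w) by (unfold w; lra).
  assert (P5 : e (l * s) ^ 2 <= (e 0 + l * w) ^ 2) by (apply pow_incr; lra).
  apply (Rmult_le_reg_l l); [lra|]. nra. }
destruct (Rle_lt_dec (k * s - w) 0) as [|Hd]; [unfold w in *; lra|exfalso].
set (D := k * s - w) in *.
assert (Hw : 0 <= w ^ 2) by apply pow2_ge_0.
assert (Hw1 : 0 < w ^ 2 + 1) by lra.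
(* Chosen so that [l * w ^ 2 < e 0 * D], against [key]. *)
set (l := Rmin 1 (e 0 * D / (w ^ 2 + 1))).
assert (Hl : 0 < l <= 1).
{ split; [|apply Rmin_l]. apply Rmin_glb_lt; [lra|].
  apply Rdiv_lt_0_compat; [nra|lra]. }
pose proof (key l Hl) as K.
assert (l * (w ^ 2 + 1) <= e 0 * D).
{ apply Rle_trans with (e 0 * D / (w ^ 2 + 1) * (w ^ 2 + 1)).
  - apply Rmult_le_compat_r; [lra|apply Rmin_r].
  - right. field. lra. }
nra.
Qed.

(** Summed over [i], the increments telescope on both sides. *)
Lemma second_difference_ge (a : nat -> R) (n : nat) (c : R) :
  (forall i, (i < n)%nat -> a (S i) - a i + c <= a (n + S i)%nat - a (n + i)%nat) ->
  INR n * c <= a (n + n)%nat - 2 * a n + a 0%nat.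
Proof.
intros H.
assert (G : forall m, (m <= n)%nat ->
          INR m * c <= (a (n + m)%nat - a n) - (a m - a 0%nat)).
{ induction m as [|m IH]; intros Hm.
  - rewrite Nat.add_0_r. simpl. lra.
  - assert (I : (m <= n)%nat) by lia. specialize (IH I).
    assert (J : (m < n)%nat) by lia. specialize (H m J).
    rewrite S_INR. lra. }
specialize (G n (Nat.le_refl n)). lra.
Qed.

(** * Geodesics *)

Section Geodesics.
Context (X : Type) (d : X -> X -> R) (HM : is_metric X d).

Lemma dist_ge0 x y : 0 <= d x y.
Proof. apply HM. Qed.

Lemma dist_sym x y : d x y = d y x.
Proof. apply HM. Qed.

Lemma dist_tri x y z : d x z <= d x y + d y z.
Proof. apply HM. Qed.

Lemma dist_refl x : d x x = 0.
Proof. apply HM. reflexivity. Qed.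

Lemma dist_eq0 x y : d x y = 0 -> x = y.
Proof. apply HM. Qed.

Lemma dist_geodesic g s t : geodesic X d g -> 0 <= s <= t -> t <= 1 ->
  d (g s) (g t) = (t - s) * d (g 0) (g 1).
Proof.
intros Hg Hs Ht. rewrite Hg by lra. rewrite Rabs_left1 by lra. lra.
Qed.

(** No order of [a] and [b] is assumed, so [a = 1], [b = 0] reverses a geodesic. *)
Lemma geodesic_sub g a b : geodesic X d g -> 0 <= a <= 1 -> 0 <= b <= 1 ->
  geodesic X d (fun t => g (a + t * (b - a))).
Proof.
intros Hg Ha Hb t s Ht Hs.
assert (I : forall u, 0 <= u <= 1 -> 0 <= a + u * (b - a) <= 1) by (intros; nra).
replace (a + 0 * (b - a)) with a by ring. replace (a + 1 * (b - a)) with b by ring.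
rewrite (Hg a b), (Hg (a + t * (b - a))) by auto.
rewrite <- Rmult_assoc, (Rabs_minus_sym a b), <- Rabs_mult. do 2 f_equal. ring.
Qed.

Lemma geodesic_const x : geodesic X d (fun _ => x).
Proof. intros t s _ _. rewrite dist_refl. ring. Qed.

Lemma geodesic_midpoint g s t : geodesic X d g -> 0 <= s <= t -> t <= 1 ->
  is_midpoint X d (g s) (g t) (g ((s + t) / 2)).
Proof.
intros Hg Hs Ht. split;
  rewrite (dist_geodesic g s t), dist_geodesic by (auto; lra); field.
Qed.

(** A diagonal [z] from [g 0] to [h 1] cuts the quadrilateral into two triangles, the second one
    read from its vertex [h 1]. *)
Lemma busemann_quadrilateral g h :
  geodesic_space X d -> busemann_convex X d -> geodesic X d g -> geodesic X d h ->
  d (g (1/2)) (h (1/2)) <= 1/2 * (d (g 0) (h 0) + d (g 1) (h 1)).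
Proof.
intros HG HB Hg Hh.
destruct (HG (g 0) (h 1)) as (z & Hz & z0 & z1).
pose proof (HB g z Hg Hz (eq_sym z0)) as A. rewrite z1 in A.
assert (I : 0 <= 0 <= 1) by lra. assert (J : 0 <= 1 <= 1) by lra.
pose proof (HB _ _ (geodesic_sub z 1 0 Hz J I) (geodesic_sub h 1 0 Hh J I)) as B.
cbv beta in B.
replace (1 + 0 * (0 - 1)) with 1 in B by field.
replace (1 + 1 / 2 * (0 - 1)) with (1 / 2) in B by field.
replace (1 + 1 * (0 - 1)) with 0 in B by field.
rewrite z0 in B. specialize (B z1).
pose proof (dist_tri (g (1/2)) (z (1/2)) (h (1/2))). lra.
Qed.

Lemma busemann_dist_convex g h t :
  geodesic_space X d -> busemann_convex X d -> geodesic X d g -> geodesic X d h ->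
  0 <= t <= 1 ->
  d (g t) (h t) <= (1 - t) * d (g 0) (h 0) + t * d (g 1) (h 1).
Proof.
intros HG HB Hg Hh.
apply (midpoint_convex_chord (fun t => d (g t) (h t))
         (d (g 0) (g 1) + d (g 0) (h 0) + d (h 0) (h 1))).
- intros u v Hu Hv.
  pose proof (busemann_quadrilateral _ _ HG HB
    (geodesic_sub g u v Hg Hu Hv) (geodesic_sub h u v Hh Hu Hv)) as A.
  cbv beta in A.
  replace (u + 0 * (v - u)) with u in A by field.
  replace (u + 1 * (v - u)) with v in A by field.
  replace (u + 1 / 2 * (v - u)) with ((u + v) / 2) in A by field.
  lra.
- intros u Hu.
  pose proof (dist_tri (g u) (g 0) (h u)). pose proof (dist_tri (g 0) (h 0) (h u)).
  rewrite (dist_sym (g u) (g 0)), (dist_geodesic g 0 u) in H by (auto; lra).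
  rewrite (dist_geodesic h 0 u) in H0 by (auto; lra).
  pose proof (dist_ge0 (g 0) (g 1)). pose proof (dist_ge0 (h 0) (h 1)). nra.
Qed.

Lemma busemann_point_convex x g l u v :
  geodesic_space X d -> busemann_convex X d -> geodesic X d g ->
  0 <= u <= 1 -> 0 <= v <= 1 -> 0 <= l <= 1 ->
  d x (g (u + l * (v - u))) <= (1 - l) * d x (g u) + l * d x (g v).
Proof.
intros HG HB Hg Hu Hv Hl.
pose proof (busemann_dist_convex _ _ l HG HB (geodesic_const x)
  (geodesic_sub g u v Hg Hu Hv) Hl) as A.
cbv beta in A.
replace (u + 0 * (v - u)) with u in A by field.
replace (u + 1 * (v - u)) with v in A by field. exact A.
Qed.

(** * Consequences of the CN inequality *)

(** CN is applied to the median from [g (1/2)] to [h (1/2)], then to the one from [h 1] to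
    [g (1/2)]; all terms but a quarter of [d (g 1) (h 1) ^ 2] cancel. *)
Lemma CN_busemann : CN X d -> busemann_convex X d.
Proof.
intros HC g h Hg Hh E.
assert (I : 0 <= 0 <= 1) by lra. assert (J : 1 <= 1) by lra.
pose proof (geodesic_midpoint g 0 1 Hg I J) as Mg.
pose proof (geodesic_midpoint h 0 1 Hh I J) as Mh.
replace ((0 + 1) / 2) with (1 / 2) in * by field.
pose proof (HC (g (1/2)) _ _ _ Mh) as A.
pose proof (HC (h 1) _ _ _ Mg) as B.
destruct Mg as [Mg _].
rewrite <- E in *.
rewrite (dist_sym (g (1/2)) (g 0)), Mg in A.
rewrite (dist_sym (h 1) (g 0)), (dist_sym (h 1) (g 1)), (dist_sym (h 1)) in B.
apply Rsqr_incr_0_var.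
- unfold Rsqr. nra.
- pose proof (dist_ge0 (g 1) (h 1)). lra.
Qed.

Lemma CN_pythagoras x g :
  CN X d -> geodesic X d g ->
  (forall t, 0 <= t <= 1 -> d x (g 0) <= d x (g t)) ->
  d x (g 0) ^ 2 + d (g 0) (g 1) ^ 2 <= d x (g 1) ^ 2.
Proof.
intros HC Hg Hx.
set (D := d (g 0) (g 1)).
(* Iterating CN on the midpoint of [g 0] and [g t]. *)
assert (key : forall n t, 0 <= t <= 1 ->
   d x (g 0) ^ 2 + (1 - (1/2) ^ n) * (t ^ 2 * D ^ 2) <= d x (g t) ^ 2).
{ induction n as [|n IH]; intros t Ht.
  - simpl. specialize (Hx t Ht). pose proof (dist_ge0 x (g 0)). nra.
  - assert (I : 0 <= t / 2 <= 1) by lra.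
    assert (I0 : 0 <= 0 <= t) by lra.
    (* A factor [c] at [t / 2] becomes [(1 + c) / 2] at [t]; from [c = 0] this produces
       [1 - (1/2) ^ n]. *)
    pose proof (HC x _ _ _ (geodesic_midpoint g 0 t Hg I0 (proj2 Ht))) as A.
    specialize (IH _ I).
    rewrite (dist_geodesic g 0 t) in A by (auto; lra). fold D in A.
    replace ((0 + t) / 2) with (t / 2) in A by field.
    replace (((1/2)) ^ S n) with (1/2 * (1/2) ^ n) by reflexivity.
    nra. }
assert (d x (g 0) ^ 2 + D ^ 2 - d x (g 1) ^ 2 <= 0); [|lra].
apply (le_0_of_le_geom _ (D ^ 2)). intro n.
assert (J : 0 <= 1 <= 1) by lra. specialize (key n 1 J). lra.
Qed.

(** Orthogonality makes [p] a nearest point of [h] to each [g t]; Pythagoras at [p] then bounds the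
    other leg [d p (h s)] as well. *)
Lemma CN_SO : CN X d -> SO X d.
Proof.
intros HC p g h Hg Hh g0 h0 (_ & _ & O). split; [|split]; auto.
intros t s Ht Hs.
assert (I : 0 <= 0 <= 1) by lra.
pose proof (CN_pythagoras (g t) _ HC (geodesic_sub h 0 s Hh I Hs)) as A.
cbv beta in A.
replace (0 + 0 * (s - 0)) with 0 in A by ring.
replace (0 + 1 * (s - 0)) with s in A by ring.
rewrite h0 in A.
apply Rsqr_incr_0_var; [|apply dist_ge0]. rewrite !Rsqr_pow2.
refine (Rle_trans _ _ _ _ (A _)).
- pose proof (pow2_ge_0 (d (g t) p)). lra.
- intros r Hr. rewrite (dist_sym _ p), (dist_sym (g t)). apply O; [nra|assumption].
Qed.

(** CN from [b] and from [e] at the midpoint of the diagonal from [a] to [c], and the triangle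
    inequality through [m]. *)
Lemma CN_quadrilateral a b c e m :
  CN X d -> is_midpoint X d a c m ->
  d a c ^ 2 + d b e ^ 2 <= d a b ^ 2 + d b c ^ 2 + d c e ^ 2 + d e a ^ 2.
Proof.
intros HC Hm.
pose proof (HC b _ _ _ Hm) as A. pose proof (HC e _ _ _ Hm) as B.
pose proof (dist_tri b m e) as T.
rewrite (dist_sym m e) in T. rewrite (dist_sym b a) in A.
rewrite (dist_sym e c) in B.
pose proof (dist_ge0 b e).
assert (d b e ^ 2 <= 2 * d b m ^ 2 + 2 * d e m ^ 2); [|lra].
pose proof (pow2_ge_0 (d b m - d e m)).
assert (d b e ^ 2 <= (d b m + d e m) ^ 2) by (apply pow_incr; lra). nra.
Qed.

(** Adding Pythagoras at the feet [p] and [q] to the quadrilateral inequality for [x], [p], [q], [y]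
    cancels all but [d p q] and [d x y]. *)
Lemma CN_NE : (forall y z, exists m, is_midpoint X d y z m) -> CN X d -> NE X d.
Proof.
intros HE HC C x y p q _ HW [Cp Hp] [Cq Hq].
assert (P : forall u a b, C a -> C b -> (forall c, C c -> d u a <= d u c) ->
              d u a ^ 2 + d a b ^ 2 <= d u b ^ 2).
{ intros u a b Ca Cb Hu. destruct (HW a b Ca Cb) as (g & Hg & g0 & g1 & Hc).
  rewrite <- g0, <- g1. apply CN_pythagoras; auto.
  intros t Ht. rewrite g0. apply Hu, Hc, Ht. }
pose proof (P x p q Cp Cq Hp) as A. pose proof (P y q p Cq Cp Hq) as B.
destruct (HE x q) as [m Hm].
pose proof (CN_quadrilateral x p q y m HC Hm) as Q.
rewrite (dist_sym q p) in B.
rewrite (dist_sym p y), (dist_sym q y), (dist_sym y x) in Q.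
apply Rsqr_incr_0_var; [|apply dist_ge0]. rewrite !Rsqr_pow2. lra.
Qed.

(** * Non-expansive projections and orthogonality *)

Lemma geodesic_image_closed g : geodesic X d g ->
  Defs.closed_set X d (fun x => exists t, 0 <= t <= 1 /\ g t = x).
Proof.
intros Hg x Hx.
(* Clamping to [0,1] gives a function continuous on the whole line, as [g] is only controlled on
   [0,1]. Its minimum is the radius. *)
set (cl := fun t => Rmax 0 (Rmin t 1)).
assert (Hcl : forall t, 0 <= cl t <= 1).
{ intro t. unfold cl, Rmax, Rmin.
  destruct (Rle_dec t 1); destruct (Rle_dec 0 _); lra. }
assert (Hcl1 : forall s t, Rabs (cl s - cl t) <= Rabs (s - t)).
{ intros s t. unfold cl, Rmax, Rmin.
  destruct (Rle_dec s 1), (Rle_dec t 1);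
  repeat destruct (Rle_dec 0 _); unfold Rabs;
  repeat destruct (Rcase_abs _); lra. }
assert (Hid : forall t, 0 <= t <= 1 -> cl t = t).
{ intros t Ht. unfold cl. rewrite Rmin_left, Rmax_right; lra. }
set (D := d (g 0) (g 1)).
assert (HD : 0 <= D) by apply dist_ge0.
assert (L : forall s t, Rabs (d x (g (cl s)) - d x (g (cl t))) <= Rabs (s - t) * D).
{ intros s t.
  assert (E : d (g (cl s)) (g (cl t)) <= Rabs (s - t) * D).
  { rewrite Hg by apply Hcl. apply Rmult_le_compat_r; auto. }
  pose proof (dist_tri x (g (cl s)) (g (cl t))) as T1.
  pose proof (dist_tri x (g (cl t)) (g (cl s))) as T2.
  rewrite (dist_sym (g (cl t))) in T2.
  apply Rabs_le. lra. }
destruct (continuity_ab_min (fun t => d x (g (cl t))) 0 1) as (u & Hu & Iu); [lra| |].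
- intros t _ eps He. exists (eps / (D + 1)). split; [apply Rdiv_lt_0_compat; lra|].
  intros s [_ Hs]. simpl in *. unfold Rdist in *.
  apply Rle_lt_trans with (1 := L s t).
  apply (Rmult_lt_compat_r (D + 1)) in Hs; [|lra].
  replace (eps / (D + 1) * (D + 1)) with eps in Hs by (field; lra).
  pose proof (Rabs_pos (s - t)). nra.
- exists (d x (g (cl u))). split.
  + destruct (dist_ge0 x (g (cl u))) as [|E]; auto.
    exfalso. apply Hx. exists (cl u). split; auto.
    symmetry. apply dist_eq0. auto.
  + intros y Hy (t & Ht & E). subst y.
    specialize (Hu t Ht). rewrite (Hid t Ht) in Hu. lra.
Qed.

Lemma geodesic_image_weakly_convex g : geodesic X d g ->
  weakly_convex X d (fun x => exists t, 0 <= t <= 1 /\ g t = x).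
Proof.
intros Hg _ _ (s & Hs & <-) (t & Ht & <-).
exists (fun r => g (s + r * (t - s))). split; [apply geodesic_sub; auto|].
repeat split; try (f_equal; ring).
intros r Hr. exists (s + r * (t - s)). split; [nra|reflexivity].
Qed.

(** On the image of [h], [h s] projects to itself and, by orthogonality, [g t] projects to [p]. *)
Lemma NE_SO : NE X d -> SO X d.
Proof.
intros HN p g h Hg Hh g0 h0 (_ & _ & O). split; [|split]; auto.
intros t s Ht Hs. rewrite (dist_sym (g t)), (dist_sym p).
apply (HN (fun x => exists u, 0 <= u <= 1 /\ h u = x)).
- apply geodesic_image_closed; auto.
- apply geodesic_image_weakly_convex; auto.
- split; [exists s; auto|]. intros. rewrite dist_refl. apply dist_ge0.
- split; [exists 0; split; [lra|auto]|].
  intros _ (u & Hu & <-). rewrite (dist_sym _ p), (dist_sym (g t)). auto.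
Qed.

End Geodesics.

(** * The product with the line *)

Section Product.
Context (M : Type) (d : M -> M -> R) (HM : is_metric M d).

Lemma prod2_sqr p q :
  prod2_dist M d p q ^ 2 = d (fst p) (fst q) ^ 2 + (snd p - snd q) ^ 2.
Proof.
unfold prod2_dist. rewrite pow2_sqrt, pow2_abs; auto.
apply Rplus_le_le_0_compat; apply pow2_ge_0.
Qed.

Lemma prod2_ge0 p q : 0 <= prod2_dist M d p q.
Proof. apply sqrt_pos. Qed.

Lemma prod2_metric : is_metric (M * R) (prod2_dist M d).
Proof.
split; [exact prod2_ge0|split; [|split]].
- intros [x a] [y b]. pose proof (prod2_sqr (x, a) (y, b)) as E. simpl fst in E.
  simpl snd in E.
  split; intros H.
  + rewrite H in E. pose proof (pow2_ge_0 (a - b)). pose proof (pow2_ge_0 (d x y)).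
    f_equal.
    * apply (dist_eq0 _ _ HM). nra.
    * nra.
  + injection H as -> ->. rewrite (dist_refl _ _ HM) in E.
    pose proof (prod2_ge0 (y, b) (y, b)). nra.
- intros [x a] [y b]. unfold prod2_dist; simpl fst; simpl snd.
  rewrite (dist_sym _ _ HM x), Rabs_minus_sym. reflexivity.
- intros [x a] [y b] [z c].
  pose proof (prod2_sqr (x, a) (y, b)) as E1.
  pose proof (prod2_sqr (y, b) (z, c)) as E2.
  pose proof (prod2_sqr (x, a) (z, c)) as E3. simpl fst in *. simpl snd in *.
  pose proof (prod2_ge0 (x, a) (y, b)) as P1.
  pose proof (prod2_ge0 (y, b) (z, c)) as P2.
  set (A := prod2_dist _ _ (x, a) (y, b)) in *.
  set (B := prod2_dist _ _ (y, b) (z, c)) in *.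
  apply Rsqr_incr_0_var; [|lra]. rewrite !Rsqr_pow2, E3.
  pose proof (dist_tri _ _ HM x y z) as T.
  pose proof (dist_ge0 _ _ HM x y). pose proof (dist_ge0 _ _ HM y z).
  pose proof (dist_ge0 _ _ HM x z).
  set (u := d x y) in *. set (v := d y z) in *.
  set (s := a - b) in *. set (t := b - c) in *.
  replace (a - c) with (s + t) by (unfold s, t; ring).
  assert (T2 : d x z ^ 2 <= (u + v) ^ 2) by (apply pow_incr; lra).
  (* Cauchy-Schwarz for the vectors [(u, s)] and [(v, t)]. *)
  assert (CS : u * v + s * t <= A * B).
  { apply Rsqr_incr_0_var; [|nra]. rewrite !Rsqr_pow2, Rpow_mult_distr, E1, E2.
    pose proof (pow2_ge_0 (u * t - s * v)). nra. }
  nra.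
Qed.

Lemma prod2_midpoint y z m a b c :
  is_midpoint (M * R) (prod2_dist M d) (y, a) (z, b) (m, c) ->
  is_midpoint M d y z m /\ c = (a + b) / 2.
Proof.
intros [H1 H2].
apply (f_equal (fun r => r ^ 2)) in H1, H2.
replace ((prod2_dist M d (y, a) (z, b) / 2) ^ 2)
  with (prod2_dist M d (y, a) (z, b) ^ 2 / 4) in * by field.
rewrite !prod2_sqr in *. simpl fst in *; simpl snd in *.
pose proof (dist_tri _ _ HM y m z) as T.
pose proof (dist_ge0 _ _ HM y m). pose proof (dist_ge0 _ _ HM m z).
pose proof (dist_ge0 _ _ HM y z).
unfold is_midpoint.
set (u := d y m) in *. set (v := d m z) in *. set (w := d y z) in *.
assert (T2 : w ^ 2 <= (u + v) ^ 2) by (apply pow_incr; lra).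
(* Parallelogram identity: the half-distances and [w <= u + v] leave no room for a difference
   between the two halves. *)
assert (E : (u - v) ^ 2 + (a - c - (c - b)) ^ 2 <= 0) by nra.
pose proof (pow2_ge_0 (u - v)). pose proof (pow2_ge_0 (a - c - (c - b))).
assert (u - v = 0) by nra. assert (a - c - (c - b) = 0) by nra.
assert (Hc : c = (a + b) / 2) by lra.
assert (u = v) by lra.
assert (u = w / 2).
{ apply Rsqr_inj; try lra. rewrite !Rsqr_pow2. subst c. nra. }
lra.
Qed.

(** On the line CN is an equality, so it adds to CN in [M]. *)
Lemma prod2_CN : CN M d -> CN (M * R) (prod2_dist M d).
Proof.
intros HC [x e] [y a] [z b] [m c] Hm.
destruct (prod2_midpoint _ _ _ _ _ _ Hm) as [Hm1 ->].
rewrite !prod2_sqr. simpl fst; simpl snd.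
pose proof (HC x y z m Hm1). nra.
Qed.

Lemma prod2_midpoint_exists : geodesic_space M d ->
  forall p q, exists m, is_midpoint (M * R) (prod2_dist M d) p q m.
Proof.
intros HG [y a] [z b]. destruct (HG y z) as (g & Hg & g0 & g1).
exists (g ((0 + 1) / 2), (a + b) / 2).
assert (I : 0 <= 0 <= 1) by lra.
destruct (geodesic_midpoint M d g 0 1 Hg I (Rle_refl 1)) as [A B].
rewrite g0, g1 in A, B.
pose proof (prod2_ge0 (y, a) (z, b)).
split; (apply Rsqr_inj; [apply prod2_ge0|lra|]); rewrite !Rsqr_pow2;
  replace ((prod2_dist M d (y, a) (z, b) / 2) ^ 2)
  with (prod2_dist M d (y, a) (z, b) ^ 2 / 4) by field;
  rewrite !prod2_sqr; simpl fst; simpl snd; rewrite ?A, ?B; field.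
Qed.

Lemma prod2_geodesic g c : geodesic M d g ->
  geodesic (M * R) (prod2_dist M d) (fun t => (g t, c * t)).
Proof.
intros Hg t s Ht Hs.
apply Rsqr_inj; [apply prod2_ge0|apply Rmult_le_pos; [apply Rabs_pos|apply prod2_ge0]|].
rewrite !Rsqr_pow2, Rpow_mult_distr, !prod2_sqr. simpl fst; simpl snd.
rewrite Hg by auto. rewrite Rpow_mult_distr, pow2_abs. ring.
Qed.

(** * From orthogonality to CN *)

(** The slope bound makes lifts with slopes of product [A * k] orthogonal; symmetry is then read at
    the end point of the lift of [et]. *)
Lemma SO_star_first_variation sg et k :
  SO_star M d -> geodesic M d sg -> geodesic M d et -> sg 0 = et 0 ->
  (forall s, 0 <= s <= 1 -> d (sg 0) (sg 1) + k * s <= d (sg 1) (et s)) ->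
  forall t, 0 <= t <= 1 ->
    d (et 0) (et 1) ^ 2 + 2 * d (sg 0) (sg 1) * k * t <= d (et 1) (sg t) ^ 2.
Proof.
intros HS Hs He E H t Ht.
set (A := d (sg 0) (sg 1)) in *. set (Y := d (et 0) (et 1)).
assert (HA : 0 <= A) by apply (dist_ge0 _ _ HM).
apply le_epsilon. intros eps Heps.
(* Only the product [A * k] of the two slopes matters, so the slope of the
   lift of [sg] may be taken small. *)
set (c := sqrt eps).
assert (Hc : 0 < c) by (apply sqrt_lt_R0; auto).
assert (Hc2 : c ^ 2 = eps) by (unfold c; rewrite pow2_sqrt; lra).
set (b := A * k / c).
assert (Hbc : b * c = A * k) by (unfold b; field; lra).
pose proof (HS (sg 0, 0) (fun t => (sg t, c * t)) (fun s => (et s, b * s))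
  (prod2_geodesic _ _ Hs) (prod2_geodesic _ _ He)) as O.
destruct O as (_ & _ & O).
- f_equal. ring.
- f_equal; [auto|ring].
- split; [f_equal; ring|split; [f_equal; [auto|ring]|]].
  intros s r Is Ir.
  apply Rsqr_incr_0_var; [|apply prod2_ge0]. rewrite !Rsqr_pow2, !prod2_sqr.
  simpl fst; simpl snd.
  rewrite (dist_geodesic M d sg) by (auto; lra). fold A.
  (* The bound on distances from [sg 1] passes to [sg r] at the cost of [(1 - r) * A]. *)
  pose proof (dist_tri _ _ HM (sg 1) (sg r) (et s)) as T.
  rewrite (dist_sym _ _ HM (sg 1) (sg r)), (dist_sym _ _ HM (sg r) (et s)) in T.
  rewrite (dist_geodesic M d sg) in T by (auto; lra). fold A in T.
  specialize (H s Is).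
  assert (L : r * A + k * s <= d (et s) (sg r)) by lra.
  pose proof (dist_ge0 _ _ HM (et s) (sg r)) as P.
  assert (Q : r ^ 2 * A ^ 2 + 2 * (b * c) * (r * s) <= d (et s) (sg r) ^ 2).
  { rewrite Hbc. set (D := d (et s) (sg r)) in *.
    destruct (Rle_lt_dec 0 (r * A + k * s)) as [L0|L0].
    - assert ((r * A + k * s) ^ 2 <= D ^ 2) by (apply pow_incr; lra).
      pose proof (pow2_ge_0 (k * s)). nra.
    - assert (0 <= r * A) by nra. pose proof (pow2_ge_0 D). nra. }
  pose proof (pow2_ge_0 (b * s)). nra.
- assert (J : 0 <= 1 <= 1) by lra.
  specialize (O t 1 Ht J).
  apply (fun h => pow_incr _ _ 2 (conj (prod2_ge0 _ _) h)) in O.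
  rewrite !prod2_sqr in O. simpl fst in O; simpl snd in O.
  rewrite E in O. fold Y in O.
  rewrite (dist_sym _ _ HM (sg t)) in O.
  assert (c ^ 2 * t ^ 2 <= eps) by (rewrite Hc2; assert (t ^ 2 <= 1) by nra; nra).
  nra.
Qed.

(** The first variation lemma with [sg] and [et] exchanged and slope [A * k / Y]; convexity turns
    bounds on squares into bounds on distances before and after. *)
Lemma first_variation_converse sg et k :
  geodesic_space M d -> busemann_convex M d -> SO_star M d ->
  geodesic M d sg -> geodesic M d et -> sg 0 = et 0 -> 0 < d (sg 0) (sg 1) ->
  (forall t, 0 <= t <= 1 ->
    d (et 0) (et 1) ^ 2 + 2 * d (sg 0) (sg 1) * k * t <= d (et 1) (sg t) ^ 2) ->
  forall s, 0 <= s <= 1 -> d (sg 0) (sg 1) + k * s <= d (sg 1) (et s).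
Proof.
intros HG HB HS Hs He E HA H.
set (A := d (sg 0) (sg 1)) in *. set (Y := d (et 0) (et 1)) in *.
assert (HY : 0 <= Y) by apply (dist_ge0 _ _ HM).
assert (cvx : forall x g l s, geodesic M d g -> 0 <= l <= 1 -> 0 <= s <= 1 ->
          d x (g (l * s)) <= (1 - l) * d x (g 0) + l * d x (g s)).
{ intros x g l s Hg Hl Is. assert (I : 0 <= 0 <= 1) by lra.
  pose proof (busemann_point_convex M d HM x g l 0 s HG HB Hg I Is Hl) as B.
  replace (0 + l * (s - 0)) with (l * s) in B by ring. exact B. }
destruct HY as [HY|HY].
- assert (E1 : d (et 1) (sg 0) = Y) by (rewrite E; apply (dist_sym _ _ HM)).
  assert (E2 : d (sg 1) (et 0) = A) by (rewrite <- E; apply (dist_sym _ _ HM)).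
  pose proof (convex_slope_of_sqr (fun t => d (et 1) (sg t)) (A * k / Y)) as S1.
  cbv beta in S1. rewrite E1 in S1.
  assert (S1' : forall t, 0 <= t <= 1 -> Y + A * k / Y * t <= d (et 1) (sg t)).
  { apply S1; auto.
    - intros; apply (dist_ge0 _ _ HM).
    - intros l s Hl Is. rewrite <- E1 at 1. apply cvx; auto.
    - intros t Ht. refine (Rle_trans _ _ _ _ (H t Ht)). right. field. lra. }
  pose proof (SO_star_first_variation et sg _ HS He Hs (eq_sym E) S1') as V.
  fold A in V. fold Y in V.
  pose proof (convex_slope_of_sqr (fun t => d (sg 1) (et t)) k) as S2.
  cbv beta in S2. rewrite E2 in S2. apply S2; auto.
  + intros; apply (dist_ge0 _ _ HM).
  + intros l s Hl Is. rewrite <- E2 at 1. apply cvx; auto.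
  + intros t Ht. refine (Rle_trans _ _ _ _ (V t Ht)). right. field. lra.
- assert (C : forall s, 0 <= s <= 1 -> et s = sg 0).
  { intros s Is. rewrite E. symmetry. apply (dist_eq0 _ _ HM).
    rewrite (dist_geodesic M d et) by (auto; lra). fold Y. rewrite <- HY. ring. }
  (* If [et] is constant, the distance from [et 1] to [sg t] is [A * t], so the hypothesis forces
     [k <= 0]; [t = k / A] refutes [k > 0]. *)
  assert (Hk : forall t, 0 < t <= 1 -> 2 * k <= A * t).
  { intros t Ht. assert (I : 0 <= t <= 1) by lra. specialize (H t I).
    rewrite C in H by lra. rewrite (dist_geodesic M d sg) in H by (auto; lra).
    fold A in H. rewrite <- HY in H.
    apply (Rmult_le_reg_l (A * t)); [nra|]. nra. }
  intros s Is. rewrite (C s Is), (dist_sym _ _ HM (sg 1)). fold A.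
  destruct (Rle_lt_dec k 0) as [|K]; [nra|exfalso].
  assert (J : 0 < 1 <= 1) by lra. pose proof (Hk 1 J) as K1.
  assert (0 < k / A) by (apply Rdiv_lt_0_compat; lra).
  assert (Ek : A * (k / A) = k) by (field; lra).
  assert (J2 : 0 < k / A <= 1) by (split; [auto|]; nra).
  specialize (Hk _ J2). lra.
Qed.

(** 1-convexity of half the squared distance, with chords for derivatives. For the function
    [u ^ 2 * L ^ 2] the gap would be [u2 - u0]; the loss vanishes as the intervals shrink. *)
Lemma sqr_dist_increment g y u0 u1 u2 u3 :
  geodesic_space M d -> busemann_convex M d -> SO_star M d -> geodesic M d g ->
  0 < d (g 0) (g 1) -> 0 <= u0 < u1 -> u1 <= u2 -> u2 < u3 -> u3 <= 1 ->
  u3 - u2 = u1 - u0 ->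
  d y (g u1) ^ 2 - d y (g u0) ^ 2 + 2 * (u1 - u0) * (u2 - u1) * d (g 0) (g 1) ^ 2
    <= d y (g u3) ^ 2 - d y (g u2) ^ 2.
Proof.
intros HG HB HS Hg HL I0 I1 I2 I3 Hd.
set (L := d (g 0) (g 1)) in *.
set (De := u1 - u0) in *.
assert (HDe : 0 < De) by (unfold De; lra).
(* The slope of half the squared distance to [y] over [[u0, u1]], per unit of length. *)
set (k := (d y (g u1) ^ 2 - d y (g u0) ^ 2) / (2 * De * L)).
assert (Hk : 2 * De * L * k = d y (g u1) ^ 2 - d y (g u0) ^ 2).
{ unfold k. field. lra. }
destruct (HG (g u1) y) as (et & He & e0 & e1).
destruct (HG (g u2) y) as (et' & He' & e0' & e1').
assert (Iu1 : 0 <= u1 <= 1) by lra. assert (Iu2 : 0 <= u2 <= 1) by lra.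
assert (Iu3 : 0 <= u3 <= 1) by lra. assert (Iu0 : 0 <= u0 <= 1) by lra.
(* Both subgeodesics end at [g u3], so [V] and [V'] concern distances from the same point. *)
set (sg := fun t => g (u1 + t * (u3 - u1))).
set (sg' := fun t => g (u2 + t * (u3 - u2))).
assert (Hsg : geodesic M d sg) by (apply geodesic_sub; auto).
assert (Hsg' : geodesic M d sg') by (apply geodesic_sub; auto).
assert (s0 : sg 0 = g u1) by (unfold sg; f_equal; ring).
assert (s1 : sg 1 = g u3) by (unfold sg; f_equal; ring).
assert (s0' : sg' 0 = g u2) by (unfold sg'; f_equal; ring).
assert (s1' : sg' 1 = g u3) by (unfold sg'; f_equal; ring).
assert (A1 : d (sg 0) (sg 1) = (u3 - u1) * L)
  by (rewrite s0, s1; apply dist_geodesic; auto; lra).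
assert (A1' : d (sg' 0) (sg' 1) = (u3 - u2) * L)
  by (rewrite s0', s1'; apply dist_geodesic; auto; lra).
assert (V : forall s, 0 <= s <= 1 -> d (sg 0) (sg 1) + k * s <= d (sg 1) (et s)).
{ apply first_variation_converse; auto.
  - rewrite s0, e0; auto.
  - rewrite A1. nra.
  - intros t Ht. rewrite e0, e1, A1, (dist_sym _ _ HM (g u1) y).
    (* [k] is the slope of the chord over [u0, u1], hence by convexity a
       lower slope to the right of [u1]. *)
    set (v := u1 + t * (u3 - u1)).
    assert (Hv : u1 <= v <= 1) by (unfold v; nra).
    assert (Iv : 0 <= v <= 1) by lra.
    change (sg t) with (g v).
    set (l := De / (v - u0)).
    assert (Hl : l * (v - u0) = De) by (unfold l, De in *; field; lra).
    assert (Il : 0 < l <= 1) by (split; unfold De in *; nra).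
    assert (Il' : 0 <= l <= 1) by lra.
    pose proof (busemann_point_convex M d HM y g l u0 v HG HB Hg Iu0 Iv Il') as B.
    replace (u0 + l * (v - u0)) with u1 in B by (rewrite Hl; unfold De; ring).
    pose proof (dist_ge0 _ _ HM y (g u1)) as P1.
    pose proof (dist_ge0 _ _ HM y (g u0)) as P0.
    pose proof (dist_ge0 _ _ HM y (g v)) as Pv.
    assert (B2 : d y (g u1) ^ 2 <= (1 - l) * d y (g u0) ^ 2 + l * d y (g v) ^ 2).
    { apply Rle_trans with (((1 - l) * d y (g u0) + l * d y (g v)) ^ 2).
      - apply pow_incr; lra.
      - assert (0 <= l * (1 - l) * (d y (g u0) - d y (g v)) ^ 2).
        { apply Rmult_le_pos; [nra|apply pow2_ge_0]. }
        nra. }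
    apply (Rmult_le_reg_l De); [auto|].
    replace (De * (d y (g u1) ^ 2 + 2 * ((u3 - u1) * L) * k * t))
      with (De * d y (g u1) ^ 2 + (2 * De * L * k) * (v - u1)) by (unfold v; ring).
    rewrite Hk.
    apply (Rmult_le_compat_r (v - u0)) in B2; [|lra].
    replace (((1 - l) * d y (g u0) ^ 2 + l * d y (g v) ^ 2) * (v - u0))
      with ((v - u0 - l * (v - u0)) * d y (g u0) ^ 2
            + (l * (v - u0)) * d y (g v) ^ 2) in B2 by ring.
    rewrite Hl in B2. unfold De in *. nra. }
(* As [et] and [et'] both end at [y], Busemann convexity bounds their distance at [s] by
   [(1 - s) * (u2 - u1) * L]; its decrease in [s] raises the slope by [(u2 - u1) * L]. *)
assert (V' : forall s, 0 <= s <= 1 ->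
          d (sg' 0) (sg' 1) + (k + (u2 - u1) * L) * s <= d (sg' 1) (et' s)).
{ intros s Is. specialize (V s Is). rewrite A1, s1 in V. rewrite A1', s1'.
  pose proof (busemann_dist_convex M d HM et et' s HG HB He He' Is) as B.
  rewrite e0, e0', e1, e1', (dist_refl _ _ HM) in B.
  rewrite (dist_geodesic M d g) in B by (auto; lra). fold L in B.
  pose proof (dist_tri _ _ HM (g u3) (et' s) (et s)) as T.
  rewrite (dist_sym _ _ HM (et' s)) in T. lra. }
assert (J : 0 <= 1 <= 1) by lra.
assert (E' : sg' 0 = et' 0) by (rewrite s0', e0'; auto).
pose proof (SO_star_first_variation sg' et' _ HS Hsg' He' E' V' 1 J) as F.
rewrite A1', e0', e1', s1', Hd, (dist_sym _ _ HM (g u2) y) in F. nra.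
Qed.

Lemma SO_star_CN_geodesic g y :
  geodesic_space M d -> busemann_convex M d -> SO_star M d -> geodesic M d g ->
  d y (g (1/2)) ^ 2
    <= d y (g 0) ^ 2 / 2 + d y (g 1) ^ 2 / 2 - d (g 0) (g 1) ^ 2 / 4.
Proof.
intros HG HB HS Hg.
destruct (dist_ge0 _ _ HM (g 0) (g 1)) as [HL|HL].
- set (L := d (g 0) (g 1)) in *.
  set (E := fun u => d y (g u) ^ 2).
  (* Cut [0,1] into [2 * n] equal intervals and pair the [i]-th with the [(n + i)]-th; the gap is
     always [n - 1] intervals, whence the factor [1 - / n], with [n] a successor. *)
  assert (key : forall n, L ^ 2 / 2 * (1 - / INR (S n)) <= E 1 - 2 * E (1/2) + E 0).
  { intro m. set (n := S m).
    set (N := INR n).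
    assert (HN : 1 <= N).
    { unfold N, n. rewrite S_INR. pose proof (pos_INR m). lra. }
    pose proof (second_difference_ge (fun i => E (INR i / (2 * N))) n
      (L ^ 2 / (2 * N ^ 2) * (N - 1))) as S.
    cbv beta in S.
    replace (INR (n + n) / (2 * N)) with 1 in S
      by (rewrite plus_INR; fold N; field; lra).
    fold N in S.
    replace (N / (2 * N)) with (1 / 2) in S by (field; lra).
    replace (INR 0 / (2 * N)) with 0 in S by (simpl; field; lra).
    replace (L ^ 2 / 2 * (1 - / N)) with (N * (L ^ 2 / (2 * N ^ 2) * (N - 1)))
      by (field; lra).
    apply S.
    intros i Hi.
    assert (HiN : INR i + 1 <= N).
    { unfold N. rewrite <- S_INR. apply le_INR. lia. }
    pose proof (pos_INR i) as Pi.
    rewrite !plus_INR, S_INR. fold N.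
    set (de := / (2 * N)).
    assert (Hde : 2 * N * de = 1) by (unfold de; field; lra).
    assert (Pde : 0 < de) by (apply Rinv_0_lt_compat; lra).
    unfold Rdiv. fold de.
    replace (L ^ 2 * / (2 * N ^ 2) * (N - 1))
      with (2 * ((INR i + 1) * de - INR i * de)
              * ((N + INR i) * de - (INR i + 1) * de) * L ^ 2)
      by (unfold de; field; lra).
    apply sqr_dist_increment; auto; nra. }
  assert (L ^ 2 / 2 <= E 1 - 2 * E (1/2) + E 0); [|unfold E in *; lra].
  apply le_epsilon. intros eps He.
  assert (HL2 : 0 < L ^ 2 / 2) by nra.
  destruct (archimed_cor1 (eps / (L ^ 2 / 2))) as (n & Hn & Pn).
  { apply Rdiv_lt_0_compat; lra. }
  destruct n as [|n]; [lia|]. specialize (key n).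
  apply (Rmult_lt_compat_l (L ^ 2 / 2)) in Hn; [|auto].
  replace (L ^ 2 / 2 * (eps / (L ^ 2 / 2))) with eps in Hn by (field; lra).
  lra.
- assert (C : forall s, 0 <= s <= 1 -> g 0 = g s).
  { intros s Is. apply (dist_eq0 _ _ HM).
    rewrite (dist_geodesic M d g) by (auto; lra). rewrite <- HL. ring. }
  rewrite <- (C (1/2)), <- (C 1), (dist_refl _ _ HM) by lra. lra.
Qed.

(** CN speaks of every midpoint, the preceding lemma only of those on a geodesic from [y] to [z];
    uniqueness of midpoints closes the gap. *)
Lemma SO_star_CN :
  geodesic_space M d -> busemann_convex M d -> SO_star M d -> CN M d.
Proof.
intros HG HB HS x y z m [m1 m2].
destruct (HG y m) as (g & Hg & g0 & g1). destruct (HG y z) as (h & Hh & h0 & h1).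
assert (I : 0 <= 0 <= 1) by lra.
destruct (geodesic_midpoint M d h 0 1 Hh I (Rle_refl 1)) as [n1 n2].
replace ((0 + 1) / 2) with (1 / 2) in * by field. rewrite h0, h1 in *.
pose proof (SO_star_CN_geodesic h) as K.
enough (m = h (1/2)) as -> by (rewrite <- h0, <- h1; apply K; auto).
(* Both are midpoints of [y] and [z], and a midpoint of the two is too close to
   [y] and [z] unless they coincide. *)
set (n := h (1/2)) in *.
destruct (HG m n) as (f & Hf & f0 & f1).
pose proof (SO_star_CN_geodesic f y HG HB HS Hf) as A.
pose proof (SO_star_CN_geodesic f z HG HB HS Hf) as B.
rewrite f0, f1 in A, B.
rewrite (dist_sym _ _ HM z m), (dist_sym _ _ HM z n) in B.
rewrite m1, n1 in A. rewrite m2, n2 in B.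
pose proof (dist_tri _ _ HM y (f (1/2)) z) as T.
rewrite (dist_sym _ _ HM (f (1/2)) z) in T.
pose proof (dist_ge0 _ _ HM y z).
pose proof (dist_ge0 _ _ HM y (f (1/2))). pose proof (dist_ge0 _ _ HM z (f (1/2))).
apply (dist_eq0 _ _ HM).
pose proof (dist_ge0 _ _ HM m n).
set (p := d y (f (1/2))) in *. set (q := d z (f (1/2))) in *.
set (w := d y z) in *.
assert (w ^ 2 <= (p + q) ^ 2) by (apply pow_incr; lra).
pose proof (pow2_ge_0 (p - q)). nra.
Qed.

(** * Comparison triangles *)

Lemma eucl_sqr p q :
  eucl p q ^ 2 = (fst p - fst q) ^ 2 + (snd p - snd q) ^ 2.
Proof.
unfold eucl. apply pow2_sqrt, Rplus_le_le_0_compat; apply pow2_ge_0.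
Qed.

(** Apollonius' identity: in the plane CN is an equality, so comparison of medians is CN. *)
Lemma eucl_median x y z :
  eucl x (emid y z) ^ 2 = eucl x y ^ 2 / 2 + eucl x z ^ 2 / 2 - eucl y z ^ 2 / 4.
Proof. rewrite !eucl_sqr. unfold emid. simpl fst; simpl snd. field. Qed.

Lemma eucl_triangle_exists a b c :
  0 <= a -> 0 <= b -> 0 <= c -> a <= b + c -> b <= a + c -> c <= a + b ->
  exists x y z, eucl x y = a /\ eucl x z = b /\ eucl y z = c.
Proof.
intros Ha Hb Hc T1 T2 T3.
assert (K : forall p q r, 0 <= r ->
          (fst p - fst q) ^ 2 + (snd p - snd q) ^ 2 = r ^ 2 -> eucl p q = r).
{ intros p q r Hr H. unfold eucl. rewrite H. apply sqrt_pow2; auto. }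
destruct Hc as [Hc|Hc].
(* Put [y] at the origin and [z] on the first axis; [u] comes from the law of cosines, and the
   triangle inequalities give [u ^ 2 <= a ^ 2]. *)
- set (u := (a ^ 2 + c ^ 2 - b ^ 2) / (2 * c)).
  assert (Hu : 2 * c * u = a ^ 2 + c ^ 2 - b ^ 2) by (unfold u; field; lra).
  assert (U1 : u <= a) by (apply (Rmult_le_reg_l (2 * c)); nra).
  assert (U2 : - a <= u) by (apply (Rmult_le_reg_l (2 * c)); nra).
  assert (V : 0 <= a ^ 2 - u ^ 2) by nra.
  pose proof (pow2_sqrt _ V) as W. set (v := sqrt (a ^ 2 - u ^ 2)) in W.
  exists (u, v), (0, 0), (c, 0).
  split; [|split]; apply K; simpl fst; simpl snd; try lra;
    rewrite !Rminus_0_r, ?W; lra.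
- exists (a, 0), (0, 0), (0, 0).
  split; [|split]; apply K; simpl fst; simpl snd; try lra; nra.
Qed.

Lemma CAT0_CN : CAT0 M d <-> CN M d.
Proof.
split.
- intros HC x y z m Hm.
  destruct (eucl_triangle_exists (d x y) (d x z) (d y z)) as (tx & ty & tz & A & B & C);
    try apply (dist_ge0 _ _ HM).
  + rewrite (dist_sym _ _ HM y z). apply (dist_tri _ _ HM).
  + apply (dist_tri _ _ HM).
  + rewrite (dist_sym _ _ HM x y). apply (dist_tri _ _ HM).
  + pose proof (HC x y z tx ty tz A B C m Hm) as D.
    rewrite <- A, <- B, <- C, <- eucl_median.
    apply pow_incr. split; [apply (dist_ge0 _ _ HM)|exact D].
- intros HC x y z tx ty tz A B C m Hm.
  apply Rsqr_incr_0_var; [|apply sqrt_pos].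
  rewrite !Rsqr_pow2, eucl_median, A, B, C. apply HC, Hm.
Qed.

End Product.

Theorem theorem19 (M : Type) (d : M -> M -> R) :
  is_metric M d -> complete M d -> geodesic_space M d ->
  uniformly_inf_convex M d ->
  (CAT0 M d <-> busemann_convex M d /\ NE_star M d) /\
  (CAT0 M d <-> busemann_convex M d /\ SO_star M d).
Proof.
intros HM _ HG _. rewrite (CAT0_CN M d HM).
pose proof (prod2_metric M d HM) as HP.
split; split.
- intros HC. split; [apply CN_busemann; auto|].
  apply CN_NE; auto.
  + apply prod2_midpoint_exists; auto.
  + apply prod2_CN; auto.
- intros [HB HN]. apply SO_star_CN; auto. apply NE_SO; auto.
- intros HC. split; [apply CN_busemann; auto|].
  apply CN_SO; auto. apply prod2_CN; auto.
- intros [HB HS]. apply SO_star_CN; auto.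
Qed.
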